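(* (i) For every connected graph $G$, $\chi_d^t(G\circ K_1)=|V(G)|+1$. (ii) For every two connected graphs $G$ and $H$, neither of which has an isolated vertex, $\chi_d^t(G\circ H)\leq \chi_d^t(G)+|V(G)|\,\chi_d^t(H)$. (iii) For every two connected graphs $G$ and $H$, $\chi_d^t(G\circ H)\leq |V(G)|+|V(H)|$.
   Context: All graphs are finite and simple (with nonempty vertex set). For a graph $G$ with no isolated vertex, a total dominator coloring (TD-coloring) of $G$ is a proper coloring of the vertices of $G$ in which each vertex of $G$ is adjacent to every vertex of some (nonempty) color class. The total dominator chromatic number $\chi_d^t(G)$ is the minimum number of color classes in a TD-coloring of $G$. For graphs $G$ and $H$, the corona $G\circ H$ is the graph arising from the disjoint union of $G$ with $|V(G)|$ copies of $H$ by adding edges between the $i$th vertex of $G$ and all vertices of the $i$th copy of $H$. $K_1$ is the one-vertex graph. *)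

(* Defs.v *)
From mathcomp Require Import all_boot.

Set Implicit Arguments.
Unset Strict Implicit.
Unset Printing Implicit Defensive.

Record sgraph := SGraph {
  svertex :> finType;
  sedge : rel svertex;
  sedge_sym : symmetric sedge;
  sedge_irr : irreflexive sedge;
  svertex_gt0 : 0 < #|svertex| }.

Definition connected (G : sgraph) : Prop :=
  forall x y : G, connect (@sedge G) x y.

Definition no_isolated (G : sgraph) : Prop :=
  forall x : G, exists y : G, sedge x y.

Section Coloring.
Variables (G : sgraph) (C : finType).
Implicit Type c : {ffun G -> C}.

Definition color_class c (a : C) : {set G} := [set u | c u == a].

(* Only nonempty classes count: colors of C that are not used are ignored. *)
Definition color_classes c : {set {set G}} := [set color_class c (c u) | u : G].

Definition proper_coloring c : bool :=
  [forall u, forall v, sedge u v ==> (c u != c v)].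

Definition td_coloring c : bool :=
  proper_coloring c &&
  [forall v : G, exists A in color_classes c, forall u in A, sedge v u].

End Coloring.

Definition has_td_coloring (G : sgraph) (k : nat) : bool :=
  [exists c : {ffun G -> 'I_k}, td_coloring c && (#|color_classes c| == k)].

(* Meaningful when G has no isolated vertex, as shown by td_chromaticP below.
   Otherwise G has no TD-coloring and the value is the default #|G|. *)
Definition td_chromatic (G : sgraph) : nat :=
  [arg min_(k < (ord_max : 'I_#|G|.+1) | has_td_coloring G k) k].

Section Corona.
Variables G H : sgraph.

(* inl x is the vertex x of G; inr (x, h) is the vertex h in the copy of H
   attached to x. *)
Definition corona_edge (p q : G + G * H) : bool :=
  match p, q with
  | inl x, inl y => sedge x y
  | inl x, inr (y, _) => x == y
  | inr (x, _), inl y => x == y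
  | inr (x, h), inr (y, k) => (x == y) && sedge h k
  end.

Lemma corona_edge_sym : symmetric corona_edge.
Proof.
move=> [x|[x h]] [y|[y k]] //=; first exact: sedge_sym.
by rewrite eq_sym sedge_sym.
Qed.

Lemma corona_edge_irr : irreflexive corona_edge.
Proof. by case=> [x|[x h]] /=; rewrite ?eqxx sedge_irr. Qed.

Lemma corona_vertex_gt0 : 0 < #|{: G + G * H}|.
Proof. by rewrite card_sum addn_gt0 svertex_gt0. Qed.

Definition corona : sgraph :=
  SGraph corona_edge_sym corona_edge_irr corona_vertex_gt0.

Lemma corona_no_isolated : no_isolated corona.
Proof.
have /card_gt0P[h _] := svertex_gt0 H.
move=> [x|[x k]]; first by exists (inr (x, h)) => /=.
by exists (inl x) => /=.
Qed.

End Corona.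

Lemma K1_gt0 : 0 < #|{: unit}|. Proof. by rewrite card_unit. Qed.

Definition K1 : sgraph :=
  @SGraph unit (fun _ _ => false) (fun _ _ => erefl) (fun _ => erefl) K1_gt0.

Lemma card_color_classes (G : sgraph) (C : finType) (c : {ffun G -> C}) :
  #|color_classes c| = #|codom c|.
Proof.
have -> : color_classes c = color_class c @: [set x in codom c].
  apply/setP=> A; apply/imsetP/imsetP=> [[u _ ->]|[a]].
    by exists (c u); rewrite ?inE ?codom_f.
  by rewrite inE => /codomP[u ->] ->; exists u.
rewrite card_in_imset ?cardsE // => a b.
rewrite !inE => /codomP[u ->] _ /setP/(_ u).
by rewrite !inE eqxx => /esym/eqP.
Qed.

Lemma td_coloring_has (G : sgraph) (C : finType) (c : {ffun G -> C}) :
  td_coloring c -> has_td_coloring G #|color_classes c|.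
Proof.
rewrite card_color_classes => /andP[pc tc].
pose d := [ffun u => enum_rank_in (codom_f c u) (c u)].
have dE u v : (d u == d v) = (c u == c v).
  rewrite !ffunE; apply/eqP/eqP => [/(congr1 enum_val)|e].
    by rewrite !enum_rankK_in ?codom_f.
  apply: enum_val_inj; by rewrite !enum_rankK_in ?codom_f.
have classE : color_classes d = color_classes c.
  apply: eq_imset => u; apply/setP=> v; by rewrite !inE dE.
apply/existsP; exists d; rewrite /td_coloring classE tc card_color_classes eqxx.
rewrite !andbT; apply/forallP=> u; apply/forallP=> v; rewrite dE.
by move/forallP: pc => /(_ u)/forallP/(_ v).
Qed.

Lemma has_td_coloring_card (G : sgraph) :
  no_isolated G -> has_td_coloring G #|G|.
Proof.
move=> nG; pose c : {ffun G -> G} := [ffun u => u].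
have <- : #|color_classes c| = #|G|.
  by rewrite card_color_classes; apply: card_codom => u v; rewrite !ffunE.
apply: td_coloring_has; apply/andP; split.
  apply/forallP=> u; apply/forallP=> v; apply/implyP=> uv; rewrite !ffunE.
  by apply: contraTneq uv => ->; rewrite sedge_irr.
apply/forallP=> v; have [w vw] := nG v; apply/existsP.
exists (color_class c (c w)); apply/andP; split; first by apply/imsetP; exists w.
by apply/forallP=> u; apply/implyP; rewrite inE !ffunE => /eqP ->.
Qed.

Lemma td_chromaticP (G : sgraph) : no_isolated G ->
  has_td_coloring G (td_chromatic G) /\
  forall (C : finType) (c : {ffun G -> C}),
    td_coloring c -> td_chromatic G <= #|color_classes c|.
Proof.
move=> nG; rewrite /td_chromatic.
case: arg_minnP => [|k hk mink]; first exact: has_td_coloring_card.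
split=> // C c tc.
have lec : #|color_classes c| < #|G|.+1.
  by rewrite ltnS; apply: leq_trans (leq_imset_card _ _) _.
exact: (mink (Ordinal lec)) (td_coloring_has tc).
Qed.

(* Main.v *)
Require Import Defs.
From mathcomp Require Import all_boot.

(** Upper bounds come from explicit colorings of the corona, whose number of
    classes is at most the number of available colors.

    For the bound by [#|G| + #|H|] ([td_chromatic_corona_le_card]), every
    vertex of [G] receives a color of its own, and all copies of [H] are colored
    injectively with one common palette of [#|H|] colors.  A vertex in the copy
    attached to [x] dominates the class [{x}].  A vertex [x] of [G] dominates
    [{y}] for any neighbor [y] in [G]; by connectedness it lacks one only if
    [G] is a single vertex, and then there is a single copy of [H], whose
    classes are singletons adjacent to [x].

    For the bound by [td_chromatic G] and [td_chromatic H]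
    ([td_chromatic_corona_le]), optimal colorings of [G] and of each copy of
    [H] are placed side by side on disjoint palettes: classes of the pieces are
    still classes of the corona, so domination is inherited piece by piece.

    For the corona with [K1], the upper bound is the first one above.
    Conversely the only neighbor of a leaf is its base vertex, so domination of
    the leaf forces each base vertex to be alone in its class
    ([pendant_class_singleton]); this makes [#|G|] classes, and the leaves need
    at least one more. *)

Lemma td_coloringP {G : sgraph} {C : finType} {c : {ffun G -> C}} :
  reflect ((forall u v, sedge u v -> c u != c v) /\
           (forall v, exists w, forall u, c u = c w -> sedge v u))
          (td_coloring c).
Proof.
apply: (iffP andP) => -[pc tc]; split.
- by move=> u v; apply/implyP; move/forallP: pc => /(_ u)/forallP.
- move=> v; move/forallP: tc => /(_ v)/existsP[A /andP[/imsetP[w _ ->]]].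
  move=> /forallP dom; exists w => u cu; have /implyP := dom u.
  by apply; rewrite inE cu.
- by apply/forallP=> u; apply/forallP=> v; apply/implyP/pc.
- apply/forallP=> v; have [w dom] := tc v; apply/existsP.
  exists (color_class c (c w)); apply/andP; split; first exact: imset_f.
  by apply/forallP=> u; apply/implyP; rewrite inE => /eqP/dom.
Qed.

Lemma td_chromatic_le_colors {G : sgraph} {C : finType} {c : {ffun G -> C}} :
  no_isolated G -> td_coloring c -> td_chromatic G <= #|C|.
Proof.
move=> nG tc; have [_ /(_ _ _ tc)/leq_trans] := td_chromaticP nG; apply.
by rewrite card_color_classes max_card.
Qed.

Lemma td_chromatic_coloring {G : sgraph} :
  no_isolated G -> exists c : {ffun G -> 'I_(td_chromatic G)}, td_coloring c.
Proof.
by move=> /td_chromaticP[/existsP[c /andP[tc _]] _]; exists c.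
Qed.

(** A class dominated by [v] is nonempty and contained in the neighborhood
    [{w}] of [v], so it is [{w}]. *)
Lemma pendant_class_singleton {G : sgraph} {C : finType} {c : {ffun G -> C}}
    {v w : G} :
  td_coloring c -> (forall u, sedge v u -> u = w) ->
  forall u, c u = c w -> u = w.
Proof.
move=> /td_coloringP[_ /(_ v)[w' dom]] pendant u cu.
by apply/pendant/dom; rewrite cu -(pendant _ (dom w' erefl)).
Qed.

(** The first step of a path from [x] to [y]. *)
Lemma connected_neighbor {G : sgraph} {x y : G} :
  connected G -> y != x -> exists z, sedge x z.
Proof.
move=> cG neq_yx; have /connectP[[|z p] /= + yE] := cG x y.
  by rewrite yE eqxx in neq_yx.
by case/andP=> xz _; exists z.
Qed.

Lemma td_chromatic_corona_le_card {G H : sgraph} :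
  connected G -> td_chromatic (corona G H) <= #|G| + #|H|.
Proof.
move=> cG; rewrite -card_sum.
pose c : {ffun corona G H -> G + H} := [ffun p : corona G H =>
  match p with inl x => inl x | inr (_, h) => inr h end].
apply: (td_chromatic_le_colors (c := c)); first exact: corona_no_isolated.
apply/td_coloringP; split.
  (move=> [x|[x h]] [y|[y k]]; rewrite !ffunE //=) => [xy|/andP[_ hk]].
    by apply: contraTneq xy => -[->]; rewrite sedge_irr.
  by apply: contraTneq hk => -[->]; rewrite sedge_irr.
move=> [x|[x h]]; last first.
  by exists (inl x) => -[y|[y k]]; rewrite !ffunE //= => -[->].
have [/existsP[y neq_yx]|/existsPn Gx] := boolP [exists y : G, y != x].
  have [z xz] := connected_neighbor cG neq_yx.
  by exists (inl z) => -[t|[t k]]; rewrite !ffunE //= => -[->].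
(* Only the copy of H at x exists here, so the class of any h is {(x, h)}. *)
have /card_gt0P[h _] := svertex_gt0 H.
exists (inr (x, h)) => -[t|[t k]]; rewrite !ffunE //= => _.
by have := Gx t; rewrite negbK eq_sym.
Qed.

Lemma td_chromatic_corona_le (G H : sgraph) :
  no_isolated G -> no_isolated H ->
  td_chromatic (corona G H) <= td_chromatic G + #|G| * td_chromatic H.
Proof.
move=> nG nH.
have [a /td_coloringP[pa da]] := td_chromatic_coloring nG.
have [b /td_coloringP[pb db]] := td_chromatic_coloring nH.
pose C : finType := ('I_(td_chromatic G) + G * 'I_(td_chromatic H))%type.
have <- : #|C| = td_chromatic G + #|G| * td_chromatic H.
  by rewrite card_sum card_prod !card_ord.
pose c : {ffun corona G H -> C} := [ffun p : corona G H =>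
  match p with inl x => inl (a x) | inr (x, h) => inr (x, b h) end].
apply: (td_chromatic_le_colors (c := c)); first exact: corona_no_isolated.
apply/td_coloringP; split.
  (move=> [x|[x h]] [y|[y k]]; rewrite !ffunE //=) => [/pa|/andP[_ /pb]].
    by apply: contraNneq => -[->].
  by apply: contraNneq => -[_ ->].
move=> [x|[x h]].
  have [w dom] := da x.
  by exists (inl w) => -[y|[y k]]; rewrite !ffunE //= => -[/dom].
have [w dom] := db h.
exists (inr (x, w)) => -[y|[y k]]; rewrite !ffunE //= => -[-> /dom ->].
by rewrite eqxx.
Qed.

Lemma td_chromatic_corona_K1_ge (G : sgraph) :
  #|G| + 1 <= td_chromatic (corona G K1).
Proof.
have [c tc] := td_chromatic_coloring (@corona_no_isolated G K1).
have base_class (x : G) (p : corona G K1) : c p = c (inl x) -> p = inl x.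
  have leaf_pendant (q : corona G K1) :
      @sedge (corona G K1) (inr (x, tt)) q -> q = inl x.
    by case: q => [y /eqP ->|[y k]] //=; rewrite andbF.
  exact: pendant_class_singleton tc leaf_pendant p.
have /card_gt0P[x0 _] := svertex_gt0 G.
(* One leaf is enough: its color differs from those of all base vertices, while
   distinct leaves may share a color. *)
pose s (z : G + unit) : corona G K1 :=
  match z with inl x => inl x | inr _ => inr (x0, tt) end.
have inj_cs : injective (c \o s).
  move=> [x|[]] [y|[]] //=; first by move=> /base_class[->].
    by move/esym/base_class.
  by move/base_class.
by have := leq_card _ inj_cs; rewrite card_sum card_unit card_ord.
Qed.

Theorem theorem4 :
  (forall G : sgraph, connected G ->
     td_chromatic (corona G K1) = #|G| + 1) /\
  (forall G H : sgraph, connected G -> connected H ->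
     no_isolated G -> no_isolated H ->
     td_chromatic (corona G H) <= td_chromatic G + #|G| * td_chromatic H) /\
  (forall G H : sgraph, connected G -> connected H ->
     td_chromatic (corona G H) <= #|G| + #|H|).
Proof.
split; [move=> G cG | split=> [G H _ _|G H cG _]].
- apply/eqP; rewrite eqn_leq td_chromatic_corona_K1_ge andbT.
  by have := td_chromatic_corona_le_card (H := K1) cG; rewrite card_unit.
- exact: td_chromatic_corona_le.
- exact: td_chromatic_corona_le_card.
Qed.
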